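(* Let $d\ge 2$ be an integer and let $\varepsilon>0$. Then there exists a constant $c$ (depending only on $d$ and $\varepsilon$) such that, for all positive integers $m,n$ with $n=dm-c$, any $n$ (not necessarily distinct) angles $\theta_1,\dots,\theta_n\in[\varepsilon,\pi-\varepsilon]$ can be realised by $m$ points in $\mathbb{R}^d$.
   Context: A set of points in $\mathbb{R}^d$ realises an angle $\theta\in(0,\pi)$ if there are points $A,B,C$ in the set such that $\angle ABC=\theta$ (the angle at $B$ between the rays $BA$ and $BC$). When angles are repeated (a tuple of angles), each angle must be realised with at least its multiplicity in the tuple, where an angle is regarded as realised multiple times if it is realised by multiple distinct (unordered) pairs of rays $\{BA,BC\}$ sharing a common starting point $B$, with $A,B,C$ in the point set; triples of points giving the same pair of rays count as the same realisation. *)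

(* Defs.v *)
From mathcomp Require Import all_boot all_order all_algebra.
From mathcomp Require Import mathcomp_extra boolp classical_sets functions.
From mathcomp Require Import cardinality reals trigo.
Set Implicit Arguments.
Unset Strict Implicit.
Unset Printing Implicit Defensive.
Import Order.TTheory GRing.Theory Num.Theory.
Local Open Scope classical_set_scope.
Local Open Scope card_scope.
Local Open Scope ring_scope.

Definition dotv (R : realType) (d : nat) (u v : 'rV[R]_d) : R :=
  \sum_(i < d) u 0 i * v 0 i.

(* MathComp-Analysis norms 'rV[R]_d by the sup norm; angles need this one. *)
Definition eucl_norm (R : realType) (d : nat) (u : 'rV[R]_d) : R :=
  Num.sqrt (dotv u u).

(* The angle ABC at the vertex B; a junk value if A = B or C = B. *)
Definition angle (R : realType) (d : nat) (A B C : 'rV[R]_d) : R :=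
  acos (dotv (A - B) (C - B) / (eucl_norm (A - B) * eucl_norm (C - B))).

Definition ray (R : realType) (d : nat) (B A : 'rV[R]_d) : set 'rV[R]_d :=
  [set X | exists2 t : R, 0 <= t & X = B + t *: (A - B)].

(* A realisation of theta is an unordered pair of rays, encoded as the set of
   these two rays; a ray determines its origin, so the vertex need not be
   recorded, and triples (A, B, C) giving the same rays are identified. *)
Definition realisations (R : realType) (d : nat) (P : set 'rV[R]_d)
    (theta : R) : set (set (set 'rV[R]_d)) :=
  [set r | exists A B C : 'rV[R]_d,
     [/\ P A, P B & P C] /\
     [/\ A <> B, C <> B, angle A B C = theta & r = [set ray B A; ray B C]]].

Definition realises (R : realType) (d n : nat) (P : set 'rV[R]_d)
    (theta : 'I_n -> R) : Prop :=
  forall t : R, [set i | theta i = t] #<= realisations P t.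

(* Main.v *)
(* Call a list of angles realisable by m points if these points can be chosen
   to avoid any given finite set. Realisations at different vertices are
   distinct, so this property is superadditive in the list and in m, and it
   suffices to cut the list of angles into pieces of two kinds.
   An angle repeated many times is realised by points of a circle: two points
   whose arc subtends theta are seen at angle theta from every point of the
   complementary arc, so T such pairs and S viewpoints give S T realisations
   with S + 2 T points, which is d per point for T = 2 d and S = 4 d.
   Distinct angles only have to be realised once each. There is a finite set,
   depending only on d and eps, such that for any d angles in the given range
   one further point X realises all of them: d - 1 of them as angles at 0
   between X and base points, which fixes the direction of X, and the last one
   as an angle at X, which fixes its norm. *)
Require Import Defs.
From mathcomp Require Import all_boot all_order all_algebra.
From mathcomp Require Import mathcomp_extra boolp classical_sets functions.
From mathcomp Require Import cardinality reals trigo.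
From mathcomp Require Import perm.
From mathcomp Require Import zify ring lra.
Import Order.TTheory GRing.Theory Num.Theory.
Local Open Scope classical_set_scope.
Local Open Scope card_scope.
Local Open Scope ring_scope.

(** * Inner products, angles and rays *)

Lemma addlKA (V : zmodType) (z x y : V) : (z + x) - (z + y) = x - y.
Proof. by rewrite (addrC z x) addrKA. Qed.

Section Geometry.
Context {R : realType} {d : nat}.
Implicit Types (u v w A B C : 'rV[R]_d) (a b c : R).

Lemma dotvC u v : dotv u v = dotv v u.
Proof. by apply: eq_bigr => i _; rewrite mulrC. Qed.

Lemma dotvDr u v w : dotv u (v + w) = dotv u v + dotv u w.
Proof. by rewrite -big_split; apply: eq_bigr => i _; rewrite mxE mulrDr. Qed.

Lemma dotvZr u a v : dotv u (a *: v) = a * dotv u v.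
Proof. by rewrite /dotv mulr_sumr; apply: eq_bigr => i _; rewrite mxE mulrCA. Qed.

Lemma dotvNr u v : dotv u (- v) = - dotv u v.
Proof. by rewrite -scaleN1r dotvZr mulN1r. Qed.

Lemma dotvDl u v w : dotv (u + v) w = dotv u w + dotv v w.
Proof. by rewrite dotvC dotvDr !(dotvC w). Qed.

Lemma dotvZl u a v : dotv (a *: u) v = a * dotv u v.
Proof. by rewrite dotvC dotvZr dotvC. Qed.

Lemma dotvNl u v : dotv (- u) v = - dotv u v.
Proof. by rewrite dotvC dotvNr dotvC. Qed.

Lemma dotv0l u : dotv 0 u = 0.
Proof. by rewrite -(scale0r 0) dotvZl mul0r. Qed.

Lemma dotv_delta u i : dotv u (delta_mx 0 i) = u 0 i.
Proof.
rewrite /dotv (bigD1 i) //= big1 => [|j ji]; first by rewrite mxE !eqxx mulr1 addr0.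
by rewrite mxE (negbTE ji) mulr0.
Qed.

Lemma dotv_gt0 u : u != 0 -> 0 < dotv u u.
Proof.
move=> u0; rewrite lt_def; apply/andP; split; last first.
  by apply: sumr_ge0 => i _; rewrite -expr2 sqr_ge0.
apply: contra u0 => /eqP u0; apply/eqP/rowP => i; rewrite mxE.
have /psumr_eq0P : forall i : 'I_d, true -> 0 <= u 0 i * u 0 i.
  by move=> j _; rewrite -expr2 sqr_ge0.
by move=> /(_ u0 i isT)/eqP; rewrite mulf_eq0 orbb => /eqP.
Qed.

Lemma eucl_norm_unit a u : 0 <= a -> dotv u u = 1 -> eucl_norm (a *: u) = a.
Proof.
by move=> a0 u1; rewrite /eucl_norm dotvZl dotvZr u1 mulr1 -expr2 sqrtr_sqr ger0_norm.
Qed.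

Lemma unit_neq a u A B : 0 < a -> dotv u u = 1 -> A - B = a *: u -> A <> B.
Proof.
move=> a0 u1 ABE AB; move: ABE; rewrite AB subrr => /esym/eqP.
rewrite scaler_eq0 gt_eqF//= => /eqP u0.
by move: u1; rewrite u0 dotv0l => /eqP; rewrite eq_sym oner_eq0.
Qed.

Lemma angle_unit A B C a c u w : 0 < a -> 0 < c ->
  dotv u u = 1 -> dotv w w = 1 -> A - B = a *: u -> C - B = c *: w ->
  angle A B C = acos (dotv u w).
Proof.
move=> a0 c0 u1 w1 ABE CBE; have [a0' c0'] := (ltW a0, ltW c0).
rewrite /Defs.angle ABE CBE !eucl_norm_unit// dotvZl dotvZr; congr acos.
by field; rewrite !gt_eqF.
Qed.

Lemma angleDl v A B C : angle (v + A) (v + B) (v + C) = angle A B C.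
Proof. by rewrite /Defs.angle !addlKA. Qed.

(** Each origin lies on the other ray and both rays point the same way, so the step from [B] to [B']
    is at once a nonnegative and a nonpositive multiple of [A - B]. *)
Lemma ray_origin A B A' B' : A <> B -> ray B A = ray B' A' -> B = B'.
Proof.
move=> AB rE.
have [t t0 tE] : ray B' A' B by rewrite -rE; exists 0; rewrite // scale0r addr0.
have [t' t'0 t'E] : ray B A B' by rewrite rE; exists 0; rewrite // scale0r addr0.
have [mu mu0 muE] : ray B A A'.
  by rewrite rE; exists 1; rewrite // scale1r addrC subrK.
(* One unit of [A - B] beyond [B']: that this point lies on the second ray excludes a reversed or
   zero [A' - B']. *)
have [nu nu0 nuE] : ray B' A' (B + (t' + 1) *: (A - B)).
  by rewrite -rE; exists (t' + 1) => //; lra.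
have uN0 : A - B != 0 by rewrite subr_eq0; apply/eqP.
have t'u : t' *: (A - B) = B' - B by apply: (addrI B); rewrite -t'E [RHS]addrC subrK.
have tu : t *: (A' - B') = B - B' by apply: (addrI B'); rewrite -tE [RHS]addrC subrK.
have vE : A' - B' = (mu - t') *: (A - B).
  by rewrite scalerBl t'u muE opprB addrA (addrC B).
have E1 : t' + t * (mu - t') = 0.
  have /eqP : (t' + t * (mu - t')) *: (A - B) = 0.
    by rewrite scalerDl -scalerA -vE t'u tu addrA subrK subrr.
  by rewrite scaler_eq0 (negbTE uN0) orbF => /eqP.
have E2 : 1 = nu * (mu - t').
  have /eqP : (1 - nu * (mu - t')) *: (A - B) = 0.
    rewrite scalerBl -scalerA -vE scale1r; apply/eqP; rewrite subr_eq0; apply/eqP.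
    apply: (addrI B'); rewrite -nuE scalerDl t'u scale1r [RHS]addrA.
    by rewrite [X in _ = X + _]addrC subrK.
  by rewrite scaler_eq0 (negbTE uN0) orbF subr_eq0 => /eqP.
have mt : 0 <= mu - t'.
  rewrite leNgt; apply/negP => /ltW mt.
  by have := mulr_ge0_le0 nu0 mt; rewrite -E2 ler10.
have t'E0 : t' = 0.
  by apply/eqP; rewrite eq_le t'0 andbT -E1 lerDl mulr_ge0.
by rewrite t'E t'E0 scale0r addr0.
Qed.

Lemma ray_eq_angle A B C : A <> B -> C <> B -> ray B A = ray B C ->
  angle A B C = 0.
Proof.
move=> /eqP + /eqP + rE; rewrite -subr_eq0 => AB; rewrite -subr_eq0 => CB.
have [t t0 tE] : ray B A C.
  by rewrite rE; exists 1; rewrite // scale1r addrC subrK.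
have CE : C - B = t *: (A - B) by rewrite {1}tE addrC addKr.
have tp : 0 < t.
  rewrite lt_def t0 andbT; apply: contra CB => /eqP t00.
  by rewrite CE t00 scale0r.
have np : 0 < eucl_norm (A - B) by rewrite sqrtr_gt0 dotv_gt0.
have nE : eucl_norm (A - B) ^+ 2 = dotv (A - B) (A - B).
  by rewrite sqr_sqrtr// ltW// dotv_gt0.
rewrite -acos1 (@angle_unit A B C (eucl_norm (A - B)) (t * eucl_norm (A - B))
  ((eucl_norm (A - B))^-1 *: (A - B)) ((eucl_norm (A - B))^-1 *: (A - B)))//.
- by rewrite dotvZl dotvZr -nE; congr acos; field; rewrite gt_eqF.
- by rewrite mulr_gt0.
- by rewrite dotvZl dotvZr -nE; field; rewrite gt_eqF.
- by rewrite dotvZl dotvZr -nE; field; rewrite gt_eqF.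
- by rewrite scalerA mulfV ?gt_eqF// scale1r.
- by rewrite scalerA mulfK ?gt_eqF.
Qed.

Lemma ray_pair_mem A A' B B' C C' :
  [set ray B A; ray B C] = [set ray B' A'; ray B' C'] ->
  ray B A = ray B' A' \/ ray B A = ray B' C'.
Proof.
move=> E; have : [set ray B A; ray B C] (ray B A) by left.
by rewrite E => -[|]; [left|right].
Qed.

Lemma ray_pair_origin A A' B B' C C' : A <> B ->
  [set ray B A; ray B C] = [set ray B' A'; ray B' C'] -> B = B'.
Proof. by move=> AB /ray_pair_mem[] /(ray_origin _ _ _ _ AB). Qed.

End Geometry.

(** * Inscribed angles on a circle *)

Section Circle.
Context {R : realType} {d : nat}.
Implicit Types a b x y : R.

Definition planar x y : 'rV[R]_d.+2 :=
  x *: delta_mx 0 ord0 + y *: delta_mx 0 (lift ord0 ord0).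

Lemma dotv_planar x y a b :
  dotv (planar x y) (planar a b) = x * a + y * b.
Proof.
rewrite /planar dotvDr !dotvZr !dotv_delta !mxE !eqxx /=.
by rewrite !mulr1 !mulr0 addr0 add0r mulrC (mulrC b).
Qed.

(* The circle of diameter 1 through 0 and the first basis vector; the
   parameter is half of the central angle, so that inscribed angles are
   differences of parameters. *)
Definition circle_pt a : 'rV[R]_d.+2 := planar (cos a ^+ 2) (cos a * sin a).

Definition chord_dir a : 'rV[R]_d.+2 := planar (- sin a) (cos a).

Lemma dotv_chord_dir a b :
  dotv (chord_dir a) (chord_dir b) = cos (b - a).
Proof. by rewrite dotv_planar cosB; ring. Qed.

Lemma chord_dir_unit a : dotv (chord_dir a) (chord_dir a) = 1.
Proof. by rewrite dotv_chord_dir subrr cos0. Qed.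

(** With half central angles as parameters, a chord is parallel to the tangent at the midpoint of
    its arc, which depends only on [a + x]. *)
Lemma circle_ptB a x :
  circle_pt a - circle_pt x = sin (a - x) *: chord_dir (a + x).
Proof.
rewrite /circle_pt /chord_dir /planar scalerDr !scalerA opprD addrACA -!scalerBl.
have [Ha Hx] := (sin2cos2 a, sin2cos2 x).
by congr (_ *: _ + _ *: _); rewrite sinB ?sinD ?cosD; ring: Ha Hx.
Qed.

Lemma circle_pt_neq v a x : 0 < a - x < pi ->
  v + circle_pt a <> v + circle_pt x.
Proof.
move=> /sin_gt0_pi ax; apply: unit_neq ax (chord_dir_unit _) _.
by rewrite addlKA circle_ptB.
Qed.

(** The chords from [x] have directions [chord_dir (a + x)] and [chord_dir (b + x)], so [x] cancels.
    The bounds make both sine factors positive, which excludes the supplementary angle. *)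
Lemma inscribed_angle v a b x : 0 < a - x -> a <= b -> b - x < pi ->
  angle (v + circle_pt a) (v + circle_pt x) (v + circle_pt b) = b - a.
Proof.
move=> ax ab bx; rewrite angleDl.
rewrite (angle_unit _ _ _ _ _ _ _ _ _ (chord_dir_unit (a + x))
  (chord_dir_unit (b + x)) (circle_ptB a x) (circle_ptB b x)); last 2 first.
- by rewrite sin_gt0_pi//; apply/andP; split; lra.
- by rewrite sin_gt0_pi//; apply/andP; split; lra.
rewrite dotv_chord_dir (_ : b + x - (a + x) = b - a); last by ring.
by rewrite cosK// in_itv /=; apply/andP; split; lra.
Qed.

Lemma ray_circle_inj v a b x : 0 < a - x < pi -> 0 < b - x < pi ->
  ray (v + circle_pt x) (v + circle_pt a) =
  ray (v + circle_pt x) (v + circle_pt b) -> a = b.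
Proof.
wlog ab : a b / a <= b => [hwlog ax bx rE|].
  have [ab|/ltW ba] := leP a b; first exact: hwlog.
  by apply/esym/hwlog.
move=> /[dup] ax' /andP[ax _] /[dup] bx' /andP[_ bx].
move=> /(ray_eq_angle _ _ _ (circle_pt_neq _ _ _ ax') (circle_pt_neq _ _ _ bx')).
by rewrite inscribed_angle// => /eqP; rewrite subr_eq0 => /eqP.
Qed.

End Circle.

(** * Lists of angles realisable by a number of points *)

(** Lists turn multiplicities into [count_mem], and the bound [size P <= m] postpones the padding to
    exactly [m] points. *)
Definition realisable (R : realType) (d : nat) (l : seq R) (m : nat) : Prop :=
  forall F : seq 'rV[R]_d, exists P : seq 'rV[R]_d,
    [/\ (size P <= m)%N, {in P, forall x, x \notin F} &
      forall t, exists s : seq (set (set 'rV[R]_d)),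
        [/\ uniq s, (count_mem t l <= size s)%N &
          {in s, forall r, realisations [set` P] t r}]].

Section Realisable.
Context {R : realType} {d : nat}.
Local Notation realisable := (@realisable R d).

Lemma realisable_perm l1 l2 m :
  perm_eq l1 l2 -> realisable l1 m -> realisable l2 m.
Proof.
move=> /seq.permP l12 rl F; have [P [Pm PF Pr]] := rl F; exists P; split=> // t.
by rewrite -l12.
Qed.

Lemma realisable_leq l m1 m2 :
  (m1 <= m2)%N -> realisable l m1 -> realisable l m2.
Proof.
move=> m12 rl F; have [P [Pm PF Pr]] := rl F.
by exists P; split=> //; exact: leq_trans m12.
Qed.

Lemma realisations_sub (P Q : set 'rV[R]_d) t :
  P `<=` Q -> realisations P t `<=` realisations Q t.
Proof.
by move=> PQ r [A [B [C [[? ? ?] ?]]]]; exists A, B, C; split=> //; split; exact: PQ.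
Qed.

Lemma realisations_disjoint (P Q : set 'rV[R]_d) t r :
  realisations P t r -> realisations Q t r -> P `&` Q !=set0.
Proof.
move=> [A [B [C [[_ PB _] [AB _ _ ->]]]]] [A' [B' [C' [[_ QB' _] [_ _ _]]]]].
by move=> /(ray_pair_origin _ _ _ _ _ _ AB) BB'; exists B; split; rewrite // BB'.
Qed.

(** The second point set is chosen to avoid the first, so the vertices are disjoint and no
    realisation is counted twice. *)
Lemma realisable_cat l1 l2 m1 m2 :
  realisable l1 m1 -> realisable l2 m2 -> realisable (l1 ++ l2) (m1 + m2).
Proof.
move=> rl1 rl2 F.
have [P1 [P1m P1F P1r]] := rl1 F; have [P2 [P2m P2F P2r]] := rl2 (F ++ P1).
exists (P1 ++ P2); split.
- by rewrite size_cat leq_add.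
- move=> x; rewrite mem_cat => /orP[/P1F//|/P2F].
  by rewrite mem_cat negb_or => /andP[].
- move=> t; have [s1 [s1u s1l s1r]] := P1r t; have [s2 [s2u s2l s2r]] := P2r t.
  exists (s1 ++ s2); split.
  + rewrite cat_uniq s1u s2u andbT; apply/hasPn => r rs2; apply/negP => rs1.
    have [x [/= xP1 xP2]] := realisations_disjoint _ _ _ _ (s1r _ rs1) (s2r _ rs2).
    by have := P2F _ xP2; rewrite mem_cat xP1 orbT.
  + by rewrite count_cat size_cat leq_add.
  + move=> r; rewrite mem_cat => /orP[/s1r|/s2r]; apply: realisations_sub => x /=;
    by rewrite mem_cat => ->; rewrite ?orbT.
Qed.

End Realisable.

(** * Translation, padding and cardinality *)

Section Extension.
Context {R : realType} {d : nat}.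

Lemma exists_notin (F : seq 'rV[R]_d.+1) : exists v, v \notin F.
Proof.
pose f (k : nat) : 'rV[R]_d.+1 := const_mx k%:R.
apply/not_existsP => allF.
have finj : injective f.
  by move=> i j /rowP/(_ ord0); rewrite !mxE => /eqP; rewrite eqr_nat => /eqP.
have := @uniq_leq_size _ (map f (iota 0 (size F).+1)) F.
rewrite map_inj_uniq// iota_uniq size_map size_iota ltnn => /(_ isT) sub.
suff: false by [].
by apply: sub => x _; have /negP/negPn := allF x.
Qed.

(** It suffices that [v] avoids the finitely many differences [y - x]. Angles are translation
    invariant, so a fixed configuration can be moved off [F]. *)
Lemma exists_translation (F P : seq 'rV[R]_d.+1) :
  exists v, {in P, forall x, v + x \notin F}.
Proof.
have [v vFP] := exists_notin [seq y - x | y <- F, x <- P].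
exists v => x xP; apply: contra vFP => vxF.
by apply/allpairsP; exists (v + x, x); rewrite /= addrK.
Qed.

Lemma extend_uniq (P : seq 'rV[R]_d.+1) m : (size P <= m)%N ->
  exists Q, [/\ uniq Q, size Q = m & {subset P <= Q}].
Proof.
move=> Pm; have : (size (undup P) <= m)%N by exact: leq_trans (size_undup _) Pm.
elim: m {Pm} => [|m IHm].
  rewrite leqn0 => /eqP P0; exists (undup P); split; rewrite ?undup_uniq//.
  by move=> x; rewrite mem_undup.
rewrite leq_eqVlt => /predU1P[Pm|/IHm[Q [Qu Qm PQ]]].
  by exists (undup P); split; rewrite ?undup_uniq// => x; rewrite mem_undup.
have [v vQ] := exists_notin Q; exists (v :: Q); split.
- by rewrite /= vQ.
- by rewrite /= Qm.
- by move=> x /PQ xQ; rewrite inE xQ orbT.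
Qed.

Lemma card_set_seq (T : eqType) (s : seq T) : uniq s -> [set` s] #= `I_(size s).
Proof.
case: s => [|x0 s] su; first by rewrite II0 card_eq0; apply/eqP/seteqP; split.
have <- : nth x0 (x0 :: s) @` `I_(size (x0 :: s)) = [set` x0 :: s].
  apply/seteqP; split=> [_ [i /= ilt <-]|x /= xs]; first exact: mem_nth.
  by exists (index x (x0 :: s)); [rewrite -index_mem in xs|exact: nth_index].
by apply: inj_card_eq => i j; rewrite !inE /= => ilt jlt /eqP; rewrite nth_uniq// => /eqP.
Qed.

Lemma realisable_realises n m (theta : 'I_n -> R) :
  realisable R d.+1 (codom theta) m ->
  exists P : set 'rV[R]_d.+1, P #= `I_m /\ realises P theta.
Proof.
move=> /(_ [::])[P [/extend_uniq[Q [Qu Qm PQ]] _ Pr]].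
exists [set` Q]; split; first by rewrite -Qm card_set_seq.
move=> t; have [s [su sl sr]] := Pr t.
pose A := [seq i <- enum 'I_n | theta i == t].
have -> : [set i | theta i = t] = [set` A].
  by apply/seteqP; split=> i /=; rewrite mem_filter mem_enum inE andbT => /eqP.
have Au : uniq A by rewrite filter_uniq// enum_uniq.
rewrite (card_le_eql (card_set_seq _ _ Au)).
apply: (@card_le_trans _ _ _ `I_(size s)).
  by rewrite card_le_II size_filter; move: sl; rewrite count_map.
rewrite -(card_le_eql (card_set_seq _ _ su)); apply: subset_card_le => r /sr.
exact: realisations_sub.
Qed.

End Extension.

(** * One angle repeated many times *)

Section Chords.
Context {R : realType} {d : nat}.

Lemma realisable_nseq (theta : R) (S T : nat) : 0 < theta < pi ->
  realisable R d.+2 (nseq (S * T) theta) (S + (T + T)).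
Proof.
move=> /andP[theta0 thetapi] F.
(* [h] is the spacing of the parameters. The first bound puts every [b k] above every [a k'], the
   second keeps [b k - x j] below [pi]. *)
have [h h0 [h1 h2]] : exists2 h : R, 0 < h &
    (S%:R + T%:R + 1) * h <= theta /\ (S%:R + T%:R + 1) * h <= pi - theta.
  have N0 : 0 < S%:R + T%:R + 1 :> R by rewrite ltr_wpDl// addr_ge0.
  exists (Num.min theta (pi - theta) / (S%:R + T%:R + 1)).
    by rewrite divr_gt0// lt_min theta0 subr_gt0.
  by rewrite mulrC divfK ?gt_eqF// !ge_min !lexx orbT.
pose x j := - (j%:R * h); pose a k := k.+1%:R * h; pose b k := a k + theta.
have xB j : (j < S)%N -> - (S%:R * h) <= x j <= 0.
  move=> jS; rewrite lerN2 oppr_le0 ler_wpM2r ?ler_nat ?(ltW h0)//=; last exact: ltnW.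
  by rewrite mulr_ge0// ltW.
have aB k : (k < T)%N -> 0 < a k <= T%:R * h.
  by move=> kT; rewrite mulr_gt0//= ler_wpM2r ?ler_nat// ltW.
have ax j k : (j < S)%N -> (k < T)%N -> 0 < a k - x j < pi.
  by move=> /xB/andP[? ?] /aB/andP[? ?]; apply/andP; split; lra.
have bx j k : (j < S)%N -> (k < T)%N -> 0 < b k - x j < pi.
  by move=> /xB/andP[? ?] /aB/andP[? ?]; apply/andP; rewrite /b; split; lra.
have [v vF] := exists_translation F [seq circle_pt t |
  t <- map x (iota 0 S) ++ (map a (iota 0 T) ++ map b (iota 0 T))].
pose pt t : 'rV[R]_d.+2 := v + circle_pt t.
exists [seq pt t | t <- map x (iota 0 S) ++ (map a (iota 0 T) ++ map b (iota 0 T))].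
split.
- by rewrite size_map !size_cat !size_map !size_iota.
- by move=> _ /mapP[t tP ->]; apply: vF; exact: map_f.
move=> t; have [<-|tN] := eqVneq theta t; last first.
  by exists [::]; split; rewrite // count_nseq /= (negbTE tN).
pose pair j k := [set ray (pt (x j)) (pt (a k)); ray (pt (x j)) (pt (b k))].
exists [seq pair j k | j <- iota 0 S, k <- iota 0 T]; split.
- apply: allpairs_uniq; rewrite ?iota_uniq// => -[j k] [j' k'].
  move=> /allpairsP[[j0 k0] [/= + + [-> ->]]] /allpairsP[[j1 k1] [/= + + [-> ->]]].
  move=> {j k j' k'}; move: j0 k0 j1 k1 => j k j' k'.
  rewrite !mem_iota !add0n => /andP[_ jS] /andP[_ kT] /andP[_ jS'] /andP[_ kT'] /= pE.
  have ne := circle_pt_neq v _ _ (ax _ _ jS kT).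
  have jj' : j = j'.
    have vE := ray_pair_origin _ _ _ _ _ _ ne pE.
    have := xB _ jS; have := xB _ jS'; have := mulr_ge0 (ler0n R T) (ltW h0).
    case: (ltgtP (x j) (x j')) => [xx|xx|/eqP + _ _ _].
    + move=> T0 /andP[? ?] /andP[? ?]; case: (circle_pt_neq v (x j') (x j)) => //.
      by apply/andP; split; lra.
    + move=> T0 /andP[? ?] /andP[? ?]; case: (circle_pt_neq v (x j) (x j')) => //.
      by apply/andP; split; lra.
    + by rewrite eqr_opp (inj_eq (mulIf (lt0r_neq0 h0))) eqr_nat => /eqP.
  rewrite -jj' in pE *; congr (_, _).
  (* The ray towards [a k] is the one towards [a k'] or [b k']; the latter is impossible because the
     values of [a] spread over less than [theta]. *)
  have [] := ray_pair_mem _ _ _ _ _ _ pE.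
    move=> /(ray_circle_inj _ _ _ _ (ax _ _ jS kT) (ax _ _ jS kT')) /eqP.
    by rewrite /a (inj_eq (mulIf (lt0r_neq0 h0))) eqr_nat eqSS => /eqP.
  move=> /(ray_circle_inj _ _ _ _ (ax _ _ jS kT) (bx _ _ jS kT')).
  have /andP[_ ?] := aB _ kT; have /andP[? _] := aB _ kT'.
  have := mulr_ge0 (ler0n R S) (ltW h0).
  by rewrite /b => *; exfalso; lra.
- by rewrite count_nseq /= eqxx mul1n size_allpairs !size_iota.
move=> _ /allpairsP[[j k] /= [+ + ->]].
rewrite !mem_iota !add0n => /andP[_ jS] /andP[_ kT].
exists (pt (a k)), (pt (x j)), (pt (b k)); split; split.
- by rewrite /= map_f// !mem_cat map_f ?orbT// mem_iota.
- by rewrite /= map_f// !mem_cat map_f ?orbT// mem_iota.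
- by rewrite /= map_f// !mem_cat map_f ?orbT// mem_iota.
- exact/circle_pt_neq/ax.
- exact/circle_pt_neq/bx.
- have /andP[ax0 _] := ax _ _ jS kT; have /andP[_ bxpi] := bx _ _ jS kT.
  by rewrite inscribed_angle// /b ?lerDl ?(ltW theta0)//; ring.
- by [].
Qed.

End Chords.

(** * As many angles as the dimension from one further point *)

Section Placement.
Context {R : realType} {d : nat}.
Local Notation V := 'rV[R]_d.+2.

(** For [i != ord0] and [|c| <= 1], this is the unit vector in the plane of coordinates 0 and [i] at
    angle [acos c] from the zeroth basis vector. *)
Definition axis (i : 'I_d.+2) (c : R) : V :=
  c *: delta_mx 0 ord0 + Num.sqrt (1 - c ^+ 2) *: delta_mx 0 i.

Lemma dotv_axis (u : V) i c :
  dotv u (axis i c) = c * u 0 ord0 + Num.sqrt (1 - c ^+ 2) * u 0 i.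
Proof. by rewrite /axis dotvDr !dotvZr !dotv_delta. Qed.

Lemma axis_unit i c : i != ord0 -> c ^+ 2 <= 1 -> dotv (axis i c) (axis i c) = 1.
Proof.
move=> i0 c1; rewrite dotv_axis !mxE !eqxx (negbTE i0) eq_sym (negbTE i0) /=.
rewrite !mulr1 !mulr0 addr0 add0r -!expr2 sqr_sqrtr ?subr_ge0//; ring.
Qed.

(* If c = cos phi and z = cos theta are close, then the i-th coordinate of u is
   forced to be small when the zeroth one y is close to 1; so |u|^2 is below 1
   at y = 1 - kappa, and it is at least 1 at y = 1. *)
Lemma exists_direction (g kappa : R) (z c : 'I_d.+2 -> R) :
  0 < kappa -> 4 * d.+2%:R * kappa <= 1 - g ^+ 2 ->
  (forall i, `|c i| <= g) -> (forall i, `|z i - c i| <= kappa) ->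
  exists2 u : V, dotv u u = 1 &
    forall i, i != ord0 -> dotv u (axis i (c i)) = z i.
Proof.
move=> k0 kg cg zc.
have d1 : 1 <= d.+2%:R :> R by rewrite ler1n.
have k1 : kappa <= 1 by have := sqr_ge0 g; nra.
have c2 i : c i ^+ 2 <= g ^+ 2.
  by rewrite -(real_normK (num_real (c i))) lerXn2r ?nnegrE// (le_trans _ (cg i)).
have s2 i : 4 * d.+2%:R * kappa <= 1 - c i ^+ 2.
  by apply: (le_trans kg); rewrite lerD2l lerN2.
have sgt0 i : 0 < 1 - c i ^+ 2 by apply: lt_le_trans (s2 i); rewrite !mulr_gt0.
(* [f i y] is the coordinate that the prescribed product with [axis i (c i)] forces on [u] when its
   zeroth coordinate is [y]; [p] is then [|u|^2 - 1], free of square roots. *)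
pose f i y := (z i - y * c i) / Num.sqrt (1 - c i ^+ 2).
pose p : {poly R} := 'X^2 + \sum_(i | i != ord0)
  ((z i)%:P - c i *: 'X) ^+ 2 * ((1 - c i ^+ 2)^-1)%:P - 1.
have pE y : p.[y] = y ^+ 2 + \sum_(i | i != ord0) f i y ^+ 2 - 1.
  rewrite /p !hornerE horner_sum; congr (_ + _ - _); apply: eq_bigr => i _.
  rewrite !hornerE /f expr_div_n sqr_sqrtr ?(ltW (sgt0 i))//; congr (_ * _); ring.
have [||y yI] := @poly_ivt _ p (1 - kappa) 1; first lra.
- rewrite !pE; apply/andP; split; last first.
    by rewrite expr1n addrC addrA addNr add0r sumr_ge0// => i _; rewrite sqr_ge0.
  (* Numerators are at most [2 * kappa] in absolute value and squared denominators at least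
     [4 * d.+2%:R * kappa], so the squares sum to at most [kappa], and
     [(1 - kappa) ^+ 2 + kappa <= 1]. *)
  have : \sum_(i | i != ord0) f i (1 - kappa) ^+ 2 <= \sum_(i < d.+2) (kappa / d.+2%:R).
    rewrite [leRHS](bigID (fun i => i != ord0)) /= -[leLHS]addr0 lerD//; last first.
      by apply: sumr_ge0 => i _; rewrite divr_ge0// ltW.
    apply: ler_sum => i _; rewrite /f expr_div_n sqr_sqrtr ?(ltW (sgt0 i))//.
    rewrite ler_pdivrMr// mulrAC ler_pdivlMr//.
    have : `|z i - (1 - kappa) * c i| <= 2 * kappa.
      rewrite (_ : _ - _ = (z i - c i) + kappa * c i); last by ring.
      apply: (le_trans (ler_normD _ _)); rewrite normrM (gtr0_norm k0).
      have c1 : `|c i| <= 1.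
        by rewrite -(ler_pXn2r (n := 2))// ?nnegrE// expr1n real_normK ?num_real//;
          have := s2 i; nra.
      have := zc i; nra.
    move: (z i - _) => w; rewrite ler_norml => /andP[w1 w2].
    apply: (@le_trans _ _ (kappa * (4 * d.+2%:R * kappa))); last by rewrite ler_pM2l.
    rewrite (_ : kappa * _ = 4 * kappa ^+ 2 * d.+2%:R); last by ring.
    by rewrite ler_pM2r ?ltr0n//; nra.
  rewrite sumr_const card_ord -[X in _ <= X]mulr_natl mulrCA mulfV ?gt_eqF// mulr1.
  move=> ?; nra.
move=> /rootP; rewrite pE => /eqP; rewrite subr_eq0 => /eqP y1.
pose u : V := \row_j (if j == ord0 then y else f j y).
exists u => [|i i0].
  rewrite /dotv (bigD1 ord0)//= mxE eqxx -y1 expr2; congr (_ + _).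
  by apply: eq_bigr => i /negbTE i0; rewrite mxE i0 expr2.
rewrite dotv_axis !mxE eqxx (negbTE i0) /f mulrCA mulfV ?gt_eqF ?sqrtr_gt0//; ring.
Qed.

(** Multiples of [kappa], with [z] rounded towards 0: as [|c| <= |z|], a bound on the cosines passes
    to the net. *)
Lemma exists_net (kappa : R) : 0 < kappa -> exists G : seq R, forall z, `|z| <= 1 ->
  exists2 c, c \in G & `|c| <= `|z| /\ `|z - c| <= kappa.
Proof.
move=> k0; exists [seq (if b then - (k%:R * kappa) else k%:R * kappa) |
  b <- [:: true; false], k <- iota 0 (Num.truncn kappa^-1).+1].
move=> z z1; pose k := Num.truncn (`|z| / kappa).
have /truncn_itv : 0 <= `|z| / kappa by rewrite divr_ge0// ltW.
rewrite -/k ler_pdivlMr// ltr_pdivrMr// -natr1 mulrDl mul1r => /andP[kz zk].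
have kk0 : 0 <= k%:R * kappa by rewrite mulr_ge0// ltW.
exists (if z < 0 then - (k%:R * kappa) else k%:R * kappa).
  apply/allpairsP; exists (z < 0, k); split => //.
    by case: (z < 0); rewrite !inE.
  rewrite mem_iota add0n ltnS le_truncn//.
  by rewrite ler_pdivrMr// mulVf ?gt_eqF.
case: ifP => z0; last first.
  rewrite ger0_norm//; split=> //; have z0' : 0 <= z by rewrite leNgt z0.
  by move: kz zk; rewrite ger0_norm// => ? ?; rewrite ger0_norm; lra.
rewrite normrN ger0_norm//; split=> //.
by move: kz zk; rewrite ltr0_norm// => ? ?; rewrite ler_norml; apply/andP; split; lra.
Qed.

(* The triangle X, 0, -a has angle pi - t1 at 0 and t0 at X, so its third angle
   is t1 - t0 > 0, and |X| comes from the law of sines. *)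
Lemma exists_apex (u a : V) (t0 t1 : R) : 0 < t0 -> t0 < t1 -> t1 < pi ->
  dotv u u = 1 -> dotv a a = 1 -> dotv u a = cos t1 ->
  exists s, [/\ 0 < s, - a <> s *: u & angle 0 (s *: u) (- a) = t0].
Proof.
move=> t00 t01 t1pi u1 a1 ua.
have s0 : 0 < sin t0 by rewrite sin_gt0_pi// t00 (lt_trans t01).
have s1 : 0 < sin t1 by rewrite sin_gt0_pi// t1pi (lt_trans t00).
have s10 : 0 < sin (t1 - t0).
  by rewrite sin_gt0_pi//; apply/andP; split; lra.
pose m := sin (t1 - t0); pose s := m / sin t0.
have sp : 0 < s by rewrite divr_gt0.
have cE0 := cos2Dsin2 t0; have cE1 := cos2Dsin2 t1.
have mE : m = sin t1 * cos t0 - cos t1 * sin t0 by rewrite /m sinB.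
(* By the law of sines the side from [s *: u] to [- a] has length [sin t1 / sin t0], so [w] is its
   unit direction. *)
pose w : V := (- sin t0 / sin t1) *: (a + s *: u).
have w1 : dotv w w = 1.
  rewrite /w dotvZl dotvZr !(dotvDr, dotvDl, dotvZr, dotvZl) u1 a1 (dotvC a) ua.
  rewrite /s mE; clear - cE0 cE1 s0 s1; move: cE0 cE1 s0 s1.
  move: (sin t0) (cos t0) (sin t1) (cos t1) => a0 b0 a1 b1 E0 E1 a00 a10.
  transitivity ((a0 ^+ 2 * (1 - b1 ^+ 2) + a1 ^+ 2 * b0 ^+ 2) / a1 ^+ 2).
    by field; rewrite !gt_eqF.
  rewrite -[RHS]E0 (_ : 1 - b1 ^+ 2 = a1 ^+ 2); last by rewrite -E1 addrAC subrr add0r.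
  by field; rewrite gt_eqF.
have wE : - a - s *: u = (sin t1 / sin t0) *: w.
  rewrite /w scalerA (_ : _ / _ * _ = -1) ?scaleN1r ?opprD//.
  by field; rewrite !gt_eqF.
have uE : 0 - s *: u = s *: (- u) by rewrite sub0r scalerN.
have Nu1 : dotv (- u) (- u) = 1 by rewrite dotvNl dotvNr opprK.
have q0 : 0 < sin t1 / sin t0 by rewrite divr_gt0.
exists s; split=> //; first exact: unit_neq q0 w1 wE.
rewrite (angle_unit _ _ _ _ _ _ _ sp q0 Nu1 w1 uE wE).
rewrite (_ : dotv _ _ = cos t0).
  by rewrite cosK// in_itv /= (ltW t00) /= ltW// (lt_trans t01).
rewrite /w dotvNl dotvZr dotvDr dotvZr ua u1 /s mE; field.
by rewrite !gt_eqF.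
Qed.

(** A finite net of cosines keeps the base points finite in number. The angles with [i != ord0] are
    realised for every length of [X], which leaves that length free for [theta ord0]. *)
Lemma exists_point (g : R) : 0 <= g -> g < 1 -> exists S : seq V,
  forall theta : 'I_d.+2 -> R,
  (forall i, 0 < theta i < pi /\ `|cos (theta i)| <= g) ->
  exists X, forall i, exists r, realisations [set` X :: S] (theta i) r.
Proof.
move=> g0 g1; pose kappa := (1 - g ^+ 2) / (4 * d.+2%:R).
have k0 : 0 < kappa by rewrite divr_gt0 ?mulr_gt0// subr_gt0 expr_lt1.
have [G GP] := exists_net _ k0.
pose axes := [seq axis i c | i <- enum 'I_d.+2, c <- G].
exists (0 :: axes ++ map -%R axes) => theta.
pose i1 : 'I_d.+2 := lift ord0 ord0.
(* The triangle for [theta ord0] needs it to be the smaller of two angles; a transposition exchanges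
   their roles. *)
wlog t01 : theta / theta ord0 <= theta i1 => [hwlog tP|tP].
  have [t01|/ltW t10] := leP (theta ord0) (theta i1); first exact: hwlog.
  have [|i|X XP] := hwlog (theta \o tperm ord0 i1).
  - by rewrite /= tpermL tpermR.
  - exact: tP.
  exists X => i; have [r] := XP (tperm ord0 i1 i); rewrite /= tpermK => rP.
  by exists r.
have cP i : exists c, c \in G /\ `|c| <= g /\ `|cos (theta i) - c| <= kappa.
  have [|c cG [cz zc]] := GP (cos (theta i)); first exact: cos_max.
  by exists c; split=> //; split=> //; apply: le_trans cz (tP i).2.
have [c /all_and2[cG /all_and2[cg zc]]] := choice cP.
have kg : 4 * d.+2%:R * kappa <= 1 - g ^+ 2.
  by rewrite mulrC divfK// mulf_neq0// pnatr_eq0.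
have [u u1 uP] := exists_direction _ _ (fun i => cos (theta i)) c k0 kg cg zc.
have axu i : i != ord0 -> dotv (axis i (c i)) (axis i (c i)) = 1.
  move=> i0; apply: axis_unit => //; rewrite -(real_normK (num_real _)) expr_le1//.
  exact: le_trans (cg i) (ltW g1).
have axS i : axis i (c i) \in axes.
  by apply/allpairsP; exists (i, c i); rewrite /= mem_enum.
have key s : 0 < s -> forall i, i != ord0 -> exists r,
    realisations [set` s *: u :: 0 :: axes ++ map -%R axes] (theta i) r.
  move=> s0 i i0; exists [set ray 0 (s *: u); ray 0 (axis i (c i))].
  exists (s *: u), 0, (axis i (c i)).
  have E1 : s *: u - 0 = s *: u by rewrite subr0.
  have E2 : axis i (c i) - 0 = 1 *: axis i (c i) by rewrite subr0 scale1r.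
  split; split=> //.
  - by rewrite /= !inE eqxx.
  - by rewrite /= !inE eqxx ?orbT.
  - by rewrite /= !inE mem_cat axS ?orbT.
  - exact: unit_neq s0 u1 E1.
  - exact: unit_neq ltr01 (axu i i0) E2.
  - rewrite (angle_unit _ _ _ _ _ _ _ s0 ltr01 u1 (axu i i0) E1 E2) uP//.
    by have [/andP[? ?] _] := tP i; rewrite cosK// in_itv /= !ltW.
have [t0 t0pi] := andP (tP ord0).1; have [t1 t1pi] := andP (tP i1).1.
(* If the two angles are equal, one realisation serves both, since each [i] only asks for
   existence. *)
move: t01; rewrite le_eqVlt => /orP[/eqP t01|t01].
  exists (1 *: u) => i; have [->|] := eqVneq i ord0; last exact: key.
  by rewrite t01; exact: key.
have [s [s0 sN sE]] := exists_apex _ _ _ _ t0 t01 t1pi u1 (axu i1 isT) (uP i1 isT).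
exists (s *: u) => i; have [->|] := eqVneq i ord0; last exact: key.
exists [set ray (s *: u) 0; ray (s *: u) (- axis i1 (c i1))].
exists 0, (s *: u), (- axis i1 (c i1)); split; split=> //.
- by rewrite /= !inE eqxx ?orbT.
- by rewrite /= !inE eqxx.
- by rewrite /= !inE mem_cat map_f ?orbT.
- apply/eqP; rewrite eq_sym scaler_eq0 gt_eqF//=; apply/eqP => u0.
  by move: u1; rewrite u0 dotv0l => /eqP; rewrite eq_sym oner_eq0.
Qed.

End Placement.

(** * Assembling the pieces *)

Section Assembly.
Context {R : realType} {d : nat}.
Local Notation V := 'rV[R]_d.+2.
Implicit Types (l : seq R) (g t : R).

Definition admissible g : pred R := fun t => (0 < t < pi) && (`|cos t| <= g).

Lemma realisations_translate (v : V) (P : seq V) t r :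
  realisations [set` P] t r ->
  exists r', realisations [set` map (+%R v) P] t r'.
Proof.
move=> [A [B [C [[/= PA PB PC] [AB CB ABC _]]]]].
exists [set ray (v + B) (v + A); ray (v + B) (v + C)], (v + A), (v + B), (v + C).
split; split; rewrite ?angleDl//=; try exact: map_f.
- by move/addrI.
- by move/addrI.
Qed.

(** [l] is cut into at most [q] blocks of at most [d.+2] angles, with one new point per block over a
    common base set [S]. *)
Lemma realise_uniq g : 0 <= g -> g < 1 -> exists S : seq V, forall q l,
  (size l <= q * d.+2)%N -> all (admissible g) l ->
  exists2 X : seq V, (size X <= q)%N &
    {in l, forall t, exists r, realisations [set` S ++ X] t r}.
Proof.
move=> g0 g1; have [S SP] := exists_point (d := d) g g0 g1; exists S.
elim=> [|q IHq] l lq lg; first by exists [::] => // t; case: l lq {lg}.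
case: l lq lg => [|t0 l'] lq lg; first by exists [::].
move: (t0 :: l') (mem_head t0 l') lq lg => l lt0 lq lg.
have gP t : t \in l -> 0 < t < pi /\ `|cos t| <= g.
  by move=> /(allP lg)/andP.
(* A short last block is padded with [t0], which lies in [l] and hence is admissible. *)
have [|Y YP] := SP (fun i : 'I_d.+2 => nth t0 (take d.+2 l) i).
  move=> i; apply: gP; have [il|il] := ltnP i (size (take d.+2 l)).
    exact/mem_take/mem_nth.
  by rewrite nth_default.
have [||X Xq XP] := IHq (drop d.+2 l).
- by rewrite size_drop leq_subLR -mulSn.
- by apply/allP => t /mem_drop/(allP lg).
exists (Y :: X) => // t; rewrite -{1}(cat_take_drop d.+2 l) mem_cat => /orP[tl|/XP[r rP]].
- have il : (index t (take d.+2 l) < d.+2)%N.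
    by rewrite (leq_trans (n := size (take d.+2 l))) ?index_mem// size_take_min geq_minl.
  have [r] := YP (Ordinal il); rewrite /= nth_index// => rP; exists r.
  apply: realisations_sub rP => x /=; rewrite mem_cat !inE => /orP[->|->//].
  by rewrite orbT.
- exists r; apply: realisations_sub rP => x /=; rewrite !mem_cat inE => /orP[->//|->].
  by rewrite !orbT.
Qed.

Lemma realisable_uniq g : 0 <= g -> g < 1 -> exists K, forall l,
  uniq l -> all (admissible g) l -> realisable R d.+2 l (K + size l %/ d.+2).
Proof.
move=> g0 g1; have [S SP] := realise_uniq g g0 g1.
(* The extra 1 pays for an incomplete last block, since the division rounds down. *)
exists (size S).+1 => l lu lg F.
have [|X Xq XP] := SP (size l %/ d.+2).+1 l _ lg.
  by rewrite ltnW// ltn_ceil.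
have [v vF] := exists_translation F (S ++ X).
exists (map (+%R v) (S ++ X)); split.
- by rewrite size_map size_cat addSnnS leq_add2l.
- by move=> _ /mapP[x xP ->]; exact: vF.
move=> t; rewrite count_uniq_mem//; have [tl|tl] := boolP (t \in l); last by exists [::].
have [r /(realisations_translate v)[r' r'P]] := XP _ tl.
by exists [:: r']; split=> // x; rewrite inE => /eqP ->.
Qed.

Lemma leq_divnD m1 m2 k : (0 < k)%N ->
  (m1 %/ k + m2 %/ k <= (m1 + m2) %/ k)%N.
Proof. by move=> k0; rewrite leq_divRL// mulnDl leq_add// leq_divM. Qed.

(** Removing one copy of each value lowers the bound on the multiplicities by one, so [M] rounds of
    the distinct case suffice and their constants add up. *)
Lemma realisable_bounded_mult g M : 0 <= g -> g < 1 -> exists K, forall l,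
  (forall t, count_mem t l <= M)%N -> all (admissible g) l ->
  realisable R d.+2 l (K + size l %/ d.+2).
Proof.
move=> g0 g1; have [K KP] := realisable_uniq g g0 g1.
elim: M => [|M [K' K'P]].
  exists 0%N => -[|t l] lM lg; last by have := lM t; rewrite /= eqxx.
  by move=> F; exists [::]; split=> // t; exists [::].
exists (K + K')%N => l lM lg.
have [l' ll'] := perm_to_subseq (undup_subseq l).
move: lg; rewrite (perm_all _ ll') all_cat => /andP[ug lg'].
rewrite (perm_size ll') size_cat; rewrite perm_sym in ll'.
apply: (realisable_perm _ _ _ ll').
apply: (realisable_leq _ (K + size (undup l) %/ d.+2 + (K' + size l' %/ d.+2))).
  by rewrite addnACA leq_add2l leq_divnD.
apply: realisable_cat; first by apply: KP => //; exact: undup_uniq.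
apply: K'P => // t; have := lM t.
rewrite -(seq.permP ll') count_cat count_uniq_mem ?undup_uniq// mem_undup.
have [tl|/count_memPn tl] := boolP (t \in l); first by rewrite add1n ltnS.
have := seq.permP ll' (pred1 t).
by rewrite tl count_cat => /eqP; rewrite addn_eq0 => /andP[_ /eqP ->].
Qed.

(** While some angle occurs more than [N] times, [N] copies of it go onto a circle; what remains has
    bounded multiplicity. *)
Lemma realisable_admissible g : 0 <= g -> g < 1 -> exists K, forall l,
  all (admissible g) l -> realisable R d.+2 l (K + size l %/ d.+2).
Proof.
move=> g0 g1; pose N := (d.+2 * 4 * (d.+2 * 2))%N.
have [K KP] := realisable_bounded_mult g N g0 g1; exists K => l.
have [n] := ubnP (size l); elim: n l => // n IHn l lsz lg.
have [lM|/existsNP[t /negP]] := pselect (forall t, count_mem t l <= N)%N.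
  exact: KP.
rewrite -ltnNge => Nt.
have [l' ll'] : exists l', perm_eq l (nseq N t ++ l').
  exists (nseq (count_mem t l - N) t ++ filter (predC1 t) l).
  rewrite catA -nseqD subnKC 1?ltnW// -size_filter.
  have /all_pred1P <- : all (pred1 t) (filter (pred1 t) l) by exact: filter_all.
  by rewrite perm_sym perm_filterC.
have tg : admissible g t.
  by apply: (allP lg); rewrite -has_pred1 has_count; exact: leq_ltn_trans Nt.
have sE : size l = (N + size l')%N by rewrite (perm_size ll') size_cat size_nseq.
move: lg; rewrite (perm_all _ ll') all_cat => /andP[_ lg'].
rewrite perm_sym in ll'; apply: (realisable_perm _ _ _ ll').
(* The circle uses [8 * d.+2] points, which is exactly [N %/ d.+2], so [K] does not grow with the
   number of removed blocks. *)
apply: (realisable_leq _ (d.+2 * 4 + (d.+2 * 2 + d.+2 * 2) + (K + size l' %/ d.+2))).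
  by rewrite sE (_ : N = d.+2 * 8 * d.+2)%N ?divnMDl// /N; lia.
apply: realisable_cat; first by apply: realisable_nseq; case/andP: tg.
by apply: IHn => //; move: lsz; rewrite sE /N; lia.
Qed.

End Assembly.

Theorem theorem3 (R : realType) (d : nat) (eps : R) :
  (2 <= d)%N -> 0 < eps ->
  exists c : nat, forall m n : nat,
    (0 < m)%N -> (0 < n)%N -> (n + c = d * m)%N ->
    forall theta : 'I_n -> R,
      (forall i, eps <= theta i <= pi - eps) ->
      exists P : set 'rV[R]_d, P #= `I_m /\ realises P theta.
Proof.
case: d => [|[|d]]// _ eps0.
(* For [eps > pi / 2] the range of angles is empty, which contradicts [0 < n]. *)
have [pi_eps|eps_pi] := ltP (pi - eps) eps.
  exists 0%N => m n _ n0 _ theta /(_ (Ordinal n0))/andP[le1 le2].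
  by have := le_trans le1 le2; rewrite leNgt pi_eps.
have pi0 : 0 < (pi : R) := pi_gt0 R.
(* [cos eps] serves as [g]: it bounds [|cos t|] on the range of angles. *)
have g0 : 0 <= cos eps by rewrite cos_ge0_pihalf//; apply/andP; split; lra.
have g1 : cos eps < 1.
  by rewrite -cos0 ltr_cos// in_itv /=; apply/andP; split; lra.
have [K KP] := realisable_admissible (d := d) _ g0 g1.
(* With [n + d.+2 * K = d.+2 * m], the bound [K + n %/ d.+2] equals [m]. *)
exists (d.+2 * K)%N => m n _ _ nm theta thetaP.
apply: realisable_realises.
have -> : m = (K + size (codom theta) %/ d.+2)%N.
  rewrite size_codom card_ord -(mulKn m (ltn0Sn d.+1)) -nm addnC.
  by rewrite mulnC divnMDl.
apply: KP; apply/allP => _ /codomP[i ->]; have /andP[le1 le2] := thetaP i.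
apply/andP; split; first by apply/andP; split; lra.
rewrite ler_norml; apply/andP; split.
  have -> : - cos eps = cos (pi - eps) by rewrite cosB cospi sinpi mul0r addr0 mulN1r.
  by rewrite leNgt ltr_cos ?in_itv /= -?leNgt//; apply/andP; split; lra.
by rewrite leNgt ltr_cos ?in_itv /= -?leNgt//; apply/andP; split; lra.
Qed.
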